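(* Let $c_0\in\mathbb C\setminus\mathcal M$. There exists $\delta_0>0$, depending only on $c_0$, such that the following holds. Let $\nu$ be any Borel probability measure on $\mathbb D(0,1)$ and let $\mathbb P$ be the product distribution on $\Omega=\mathbb D(0,1)^{\mathbb N}$ generated by $\nu$. Then the function $$\lambda\mapsto\mathbf g_\lambda(0)=\int_{\Omega}g_{\lambda,\omega}(0)\,d\mathbb P(\omega)$$ is harmonic in $\Lambda=\mathbb D(0,\delta_0)$.
   Context: $\mathcal M$ is the Mandelbrot set, i.e. the set of $c\in\mathbb C$ for which the orbit of $0$ under $f_c(z)=z^2+c$ is bounded. For $\omega=(v_0,v_1,\dots)\in\Omega=\mathbb D(0,1)^{\mathbb N}$ and $\lambda\in\mathbb C$ put $$f^n_{\lambda,\omega}=f_{c_0+\lambda v_{n-1}}\circ\dots\circ f_{c_0+\lambda v_1}\circ f_{c_0+\lambda v_0}.$$ The basin of infinity is $\mathcal A_{\lambda,\omega}=\{z\in\mathbb C: f^n_{\lambda,\omega}(z)\to\infty\}$, and the Green function is $g_{\lambda,\omega}(z)=\lim_{n\to\infty}2^{-n}\ln|f^n_{\lambda,\omega}(z)|$ for $z\in\mathcal A_{\lambda,\omega}$ (the limit exists), $g_{\lambda,\omega}(z)=0$ otherwise. *)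

(* Defs.v *)
From HB Require Import structures.
From mathcomp Require Import all_boot all_order all_algebra.
From mathcomp Require Import complex.
From mathcomp Require Import all_classical all_reals all_analysis.
Set Implicit Arguments.
Unset Strict Implicit.
Unset Printing Implicit Defensive.
Import Order.TTheory GRing.Theory Num.Theory.
Import numFieldTopology.Exports numFieldNormedType.Exports.
Import ComplexField.Normc.

Local Open Scope classical_set_scope.
Local Open Scope ring_scope.
Local Open Scope complex_scope.

Definition quad {R : realType} (c z : R[i]) : R[i] := z ^+ 2 + c.

Definition mandelbrot {R : realType} : set R[i] :=
  [set c | exists M : R, forall n : nat, normc (iter n (quad c) 0) <= M].

(* [normc] is R-valued, while [`|z|] is the same real number seen in R[i]. *)
Definition cdisk {R : realType} (r : R) : set R[i] := [set z | normc z < r].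

Definition udisk (R : realType) : Type := {z : R[i] | normc z < 1}.

Definition udisk_val {R : realType} (v : udisk R) : R[i] := sval v.

Lemma normc0_lt1 (R : realType) : normc (0 : R[i]) < 1.
Proof. by have -> : normc (0 : R[i]) = 0 := normc0 R; exact: ltr01. Qed.

HB.instance Definition _ (R : realType) := Choice.on (udisk R).
HB.instance Definition _ (R : realType) :=
  isPointed.Build (udisk R) (exist _ 0 (normc0_lt1 R)).

(* The open sets of the disk are the traces of the open sets of the plane; the
   library puts the topology of the plane on the copy R[i]^o of R[i]. *)
Definition udisk_open (R : realType) : set (set (udisk R)) :=
  [set udisk_val @^-1` U | U in (open : set (set R[i]^o))].

Definition udisk_borel (R : realType) := g_sigma_algebraType (@udisk_open R).

Definition one_cylinders (R : realType) : set (set (nat -> udisk_borel R)) :=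
  \bigcup_(n : nat)
    preimage_set_system setT (fun w : nat -> udisk_borel R => w n) measurable.

(* The sequences (v_0, v_1, ...) of points of the disk, with the smallest
   sigma-algebra that makes every coordinate measurable. *)
Definition Omega (R : realType) := g_sigma_algebraType (@one_cylinders R).

(* There is no infinite product measure in the library: the product
   distribution is characterized as the (unique) probability that gives each
   finite-dimensional cylinder the product of the nu-masses of its sides. *)
Definition is_product_distribution {R : realType}
    (nu : probability (udisk_borel R) R) (P : probability (Omega R) R) : Prop :=
  forall (n : nat) (A : nat -> set (udisk_borel R)),
    (forall i, measurable (A i)) ->
    P [set w | forall i, (i < n)%N -> A i (w i)] = (\prod_(i < n) nu (A i))%E.

(* f^n_{lambda,w}(z): f_{c_0 + lambda v_0} is applied first. *)
Fixpoint random_orbit {R : realType} (c0 lambda : R[i]) (w : nat -> udisk R)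
    (n : nat) (z : R[i]) : R[i] :=
  if n is m.+1
  then quad (c0 + lambda * udisk_val (w m)) (random_orbit c0 lambda w m z)
  else z.

Definition basin {R : realType} (c0 lambda : R[i]) (w : nat -> udisk R) :
    set R[i] :=
  [set z | normc (random_orbit c0 lambda w n z) @[n --> \oo] --> +oo].

(* [ln 0 = 0]; in the basin the orbit vanishes only finitely often. *)
Definition green {R : realType} (c0 lambda : R[i]) (w : nat -> udisk R)
    (z : R[i]) : R :=
  if z \in basin c0 lambda w
  then lim (2 ^- n * ln (normc (random_orbit c0 lambda w n z)) @[n --> \oo])
  else 0.

Definition mean_green {R : realType} (c0 : R[i]) (P : probability (Omega R) R)
    (z lambda : R[i]) : R :=
  \int[P]_(w in setT) green c0 lambda w z.

Section harmonic.
Context {R : realType}.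
Implicit Types (W : set (R * R)) (v : R * R -> R).

Definition dx v : R * R -> R := 'D_(1, 0) v.
Definition dy v : R * R -> R := 'D_(0, 1) v.

Definition C1_on W v := forall p, W p ->
  [/\ derivable v p (1, 0), derivable v p (0, 1),
      {for p, continuous (dx v)} & {for p, continuous (dy v)}].

Definition C2_on W v := [/\ C1_on W v, C1_on W (dx v) & C1_on W (dy v)].

(* A function on R[i] is viewed as a function of its real coordinates; W is
   meant to be open. *)
Definition harmonic_on (U : set R[i]) (u : R[i] -> R) :=
  let v := fun p : R * R => u (p.1 +i* p.2) in
  let W := [set p : R * R | U (p.1 +i* p.2)] in
  C2_on W v /\ forall p, W p -> dx (dx v) p + dy (dy v) p = 0.

End harmonic.

(* Main.v *)
(* On the disk of radius 2 delta0 the orbit of 0 has left a large disk at a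
   time N that does not depend on w, and never vanishes afterwards.
   As f^n_{lambda,w}(0) is a polynomial in lambda of degree at most 2^n,
   2^-n ln |f^n_{lambda,w}(0)| is, up to an additive constant, a subaverage of
   potentials ln |lambda - a| with |a| >= 2 delta0.  Every inequality bounding
   the value on such potentials of a finite linear combination of point
   evaluations of total weight zero therefore passes to these functions, to
   their limit g_{lambda,w}(0), and to its expectation.  The bounds on the first
   and second difference quotients of ln |lambda - a|, uniform in a, are of this
   kind; they force the expectation to be C^2, and the approximate
   cancellation of the two pure second quotients makes it harmonic. *)

Require Import Defs.
From mathcomp Require Import all_boot all_order all_algebra.
From mathcomp Require Import complex.
From mathcomp Require Import ring lra.
From mathcomp Require Import all_classical all_reals all_analysis.
Import Order.TTheory GRing.Theory Num.Theory.
Import numFieldTopology.Exports numFieldNormedType.Exports.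
From mathcomp Require Import measurable_realfun.
Import ComplexField.Normc.
Local Open Scope classical_set_scope.
Local Open Scope ring_scope.

(** * Taylor estimates for [ln |.|] on the complex plane *)

Section ComplexModulus.
Context {R : realType}.
Local Open Scope complex_scope.
Implicit Types (z w a m n : R[i]) (s t d : R).

Lemma normc_ge0 z : 0 <= normc z.
Proof. by case: z => x y; exact: sqrtr_ge0. Qed.

Lemma normc_gt0 z : (0 < normc z) = (z != 0).
Proof.
rewrite lt_def normc_ge0 andbT; congr (~~ _).
apply/eqP/eqP => [/eq0_normc//|->]; exact: normc0.
Qed.

Lemma normcD_le z w : normc (z + w) <= normc z + normc w.
Proof. exact: le_normcD. Qed.

Lemma normcN_eq z : normc (- z) = normc z.
Proof. exact: normcN. Qed.

Lemma normc_distC z w : normc (z - w) = normc (w - z).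
Proof. by rewrite -normcN_eq opprB. Qed.

Lemma normcB_ge z w : normc z - normc w <= normc (z + w).
Proof.
rewrite lerBlDr -(normcN_eq w); apply: le_trans (normcD_le _ _).
by rewrite addrK.
Qed.

Lemma normc_real s : normc s%:C = `|s|.
Proof. by rewrite /normc /= expr0n addr0 sqrtr_sqr. Qed.

Lemma normcX z k : normc (z ^+ k) = normc z ^+ k.
Proof.
elim: k => [|k ih]; first by rewrite !expr0; exact: normc1.
by rewrite !exprS normcM ih.
Qed.

Lemma normr_Re_le z : `|complex.Re z| <= normc z.
Proof. by have := normc_ge_Re z; rewrite lecR. Qed.

Lemma ReD z w : complex.Re (z + w) = complex.Re z + complex.Re w.
Proof. by case: z w => a b [c e]. Qed.

Lemma ReB z w : complex.Re (z - w) = complex.Re z - complex.Re w.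
Proof. by case: z w => a b [c e]. Qed.

Lemma Re_scale s z : complex.Re (s%:C * z) = s * complex.Re z.
Proof. by case: z => a b /=; rewrite mul0r subr0. Qed.

Lemma ln_normcM z w : z != 0 -> w != 0 ->
  ln (normc (z * w)) = ln (normc z) + ln (normc w).
Proof. by move=> z0 w0; rewrite normcM lnM// posrE normc_gt0. Qed.

Lemma ln_normc_div z w : z != 0 -> w != 0 ->
  ln (normc (z / w)) = ln (normc z) - ln (normc w).
Proof. by move=> z0 w0; rewrite normcM normcV ln_div// posrE normc_gt0. Qed.

(** With [t = 2 Re w + |w|^2] one has [|1 + w|^2 = 1 + t], so the logarithm is [ln (1 + t) / 2], and
    [t / (1 + t) <= ln (1 + t) <= t] controls it to second order. *)
Lemma ln_normc1D_le w : normc w <= 2^-1 ->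
  `|ln (normc (1 + w)) - complex.Re w| <= 8 * normc w ^+ 2.
Proof.
case: w => a b; set r := normc _ => r2.
have r0 : 0 <= r by exact: normc_ge0.
have rE : r ^+ 2 = a ^+ 2 + b ^+ 2.
  by rewrite /r /= sqr_sqrtr// addr_ge0// sqr_ge0.
have ar : `|a| <= r := normr_Re_le (a +i* b).
have [ar1 ar2] : - r <= a /\ a <= r by apply/andP; rewrite -ler_norml.
set t := 2 * a + r ^+ 2.
(* Since [a >= - r], [1 + t] is at least [(1 - r)^2], hence at least [1 / 4]. *)
have t1 : 4^-1 <= 1 + t by rewrite /t; nra.
have -> : normc (1 + (a +i* b)) = Num.sqrt (1 + t).
  by rewrite /normc /= /t rE; congr Num.sqrt; ring.
have -> : ln (Num.sqrt (1 + t)) = ln (1 + t) / 2.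
  have s0 : 0 < Num.sqrt (1 + t) by rewrite sqrtr_gt0; lra.
  rewrite -{2}(@sqr_sqrtr _ (1 + t)); last by lra.
  by rewrite lnXn// mulr2n; lra.
have up : ln (1 + t) <= t by apply: le_ln1Dx; lra.
(* This is [ln (1 + x) <= x] at [x = (1 + t)^-1 - 1]. *)
have lo : t / (1 + t) <= ln (1 + t).
  have p0 : 0 < 1 + t by lra.
  have i0 : 0 < (1 + t)^-1 by rewrite invr_gt0.
  have := @le_ln1Dx _ ((1 + t)^-1 - 1).
  have -> : 1 + ((1 + t)^-1 - 1) = (1 + t)^-1 by ring.
  rewrite lnV ?posrE// => h.
  have -> : t / (1 + t) = 1 - (1 + t)^-1 by field; rewrite gt_eqF.
  have : - ln (1 + t) <= (1 + t)^-1 - 1 by apply: h; lra.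
  lra.
(* The 16 is twice the 8 of the statement, because the logarithm is halved. *)
have lo2 : 2 * a - 16 * r ^+ 2 <= t / (1 + t).
  rewrite ler_pdivlMr; last by lra.
  by rewrite /t; nra.
rewrite ler_norml /=; apply/andP; split; rewrite /t in up lo lo2 *; nra.
Qed.

(** Factoring [a + s m = a (1 + w)] with [w = s m / a] reduces this to [ln_normc1D_le]; the
    remainder [8 |w|^2 <= 8 s^2 / d^2] loses one factor [|s|] in the quotient. *)
Lemma ln_normcD_quot_le d a m s : 0 < d -> d <= normc a -> normc m = 1 ->
  s != 0 -> `|s| <= d / 2 ->
  `|s^-1 * (ln (normc (a + s%:C * m)) - ln (normc a)) - complex.Re (m / a)|
    <= 8 / d ^+ 2 * `|s|.
Proof.
move=> d0 da m1 s0 sd.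
have na : 0 < normc a by lra.
have a0 : a != 0 by rewrite -normc_gt0.
set w := s%:C * (m / a).
have wE : normc w = `|s| / normc a.
  by rewrite /w !normcM normcV normc_real m1 mul1r.
have wd : normc w <= `|s| / d.
  by rewrite wE ler_wpM2l// lef_pV2// posrE.
have w2 : normc w <= 2^-1.
  by apply: le_trans wd _; rewrite ler_pdivrMr// mulrC.
have w10 : 1 + w != 0.
  rewrite -normc_gt0; have := normcB_ge 1 w.
  by have -> : normc (1 : R[i]) = 1 := normc1 R; lra.
have -> : a + s%:C * m = a * (1 + w).
  by rewrite /w mulrDr mulr1 mulrCA (mulrC m) mulVKf.
rewrite ln_normcM// addrAC subrr add0r.
have -> : complex.Re (m / a) = s^-1 * complex.Re w.
  by rewrite /w Re_scale mulKf.
rewrite -mulrBr normrM normfV.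
have s1 : 0 < `|s| by rewrite normr_gt0.
rewrite mulrC ler_pdivrMr//; apply: le_trans (ln_normc1D_le _ w2) _.
have : normc w ^+ 2 <= (`|s| / d) ^+ 2.
  by rewrite ler_pXn2r// nnegrE ?normc_ge0// divr_ge0// ltW.
rewrite expr_div_n => h; apply: le_trans (_ : 8 * (`|s| ^+ 2 / d ^+ 2) <= _).
  by rewrite ler_pM2l.
rewrite le_eqVlt; apply/orP; left; apply/eqP; field.
by rewrite gt_eqF.
Qed.

(** As [ln |.|] is locally the real part of a holomorphic logarithm, its second derivative along [m]
    and [n] is [- Re (m n / a^2)], whence the plus sign. The 5 is 4 for the Taylor remainder plus 1
    for replacing [b c] by [a ^+ 2]. *)
Lemma ln_normcD_quot2_le d a m n s t (b := a + s%:C * m) (c := a + t%:C * n) :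
  0 < d -> d <= normc a -> d <= normc b -> d <= normc c ->
  b + t%:C * n != 0 -> normc m = 1 -> normc n = 1 ->
  s != 0 -> t != 0 -> `|s| <= d / 2 -> `|t| <= d / 2 ->
  `|s^-1 * t^-1 * (ln (normc (b + t%:C * n)) - ln (normc b) - ln (normc c)
      + ln (normc a)) + complex.Re (m * n / a ^+ 2)|
    <= 5 / d ^+ 3 * (`|s| + `|t|).
Proof.
move=> d0 da db dc e0 m1 n1 s0 t0 sd td.
have nz z : d <= normc z -> z != 0.
  by move=> dz; rewrite -normc_gt0; apply: lt_le_trans dz.
have a0 := nz _ da; have b0 := nz _ db; have c0 := nz _ dc.
have inv_le z : d <= normc z -> (normc z)^-1 <= d^-1.
  by move=> dz; rewrite lef_pV2// posrE//; apply: lt_le_trans dz.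
have inv_ge0 z : 0 <= (normc z)^-1 by rewrite invr_ge0 normc_ge0.
have s1 : 0 < `|s| by rewrite normr_gt0.
have t1 : 0 < `|t| by rewrite normr_gt0.
pose k := - (m * n / (b * c)).
pose w := (s * t)%:C * k.
have kd : normc k <= d^-1 * d^-1.
  rewrite /k normcN_eq !normcM normcV normcM m1 n1 !mul1r invfM.
  by rewrite ler_pM// inv_le.
have wE : normc w <= `|s| * `|t| * (d^-1 * d^-1).
  by rewrite /w normcM normc_real normrM ler_wpM2l// mulr_ge0.
have sd' : `|s| * d^-1 <= 2^-1 by rewrite ler_pdivrMr// mulrC.
have td' : `|t| * d^-1 <= 2^-1 by rewrite ler_pdivrMr// mulrC.
have w2 : normc w <= 2^-1.
  apply: le_trans wE _; rewrite mulrACA.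
  apply: le_trans (_ : 2^-1 * 2^-1 <= _); last by lra.
  by rewrite ler_pM// mulr_ge0// invr_ge0 ltW.
(* This rests on [(a + s m) (a + t n) - s t m n = a (a + s m + t n)]. *)
have wdef : 1 + w = (b + t%:C * n) * a / (b * c).
  rewrite /w /k rmorphM /b /c; field.
  by rewrite b0 c0.
(* The second difference of [ln |.|] is [ln |1 + w|] with [w = O(s t)]. *)
have -> : ln (normc (b + t%:C * n)) - ln (normc b) - ln (normc c) + ln (normc a)
    = ln (normc (1 + w)).
  rewrite wdef ln_normc_div ?mulf_neq0// !ln_normcM//; ring.
have -> : s^-1 * t^-1 * ln (normc (1 + w)) + complex.Re (m * n / a ^+ 2) =
    s^-1 * t^-1 * (ln (normc (1 + w)) - complex.Re w) +
    complex.Re (m * n / a ^+ 2 + k).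
  have -> : complex.Re w = s * t * complex.Re k by rewrite /w Re_scale.
  by rewrite ReD; field; rewrite s0 t0.
(* [1 / a^2] is compared with [1 / (b c)] through [1 / (a b)]. *)
have kE : m * n / a ^+ 2 + k =
    s%:C * (m * m * n / (a ^+ 2 * b)) + t%:C * (m * n * n / (a * b * c)).
  by rewrite /k /b /c; field; rewrite a0 b0 c0.
(* The remainder is of order [s^2 t^2 / d^4]; division by [|s t|] leaves [|s| |t| / d^4], of which
   [|t| / d] is bounded by [1 / 2]. *)
have bd1 : `|s^-1 * t^-1 * (ln (normc (1 + w)) - complex.Re w)|
    <= 4 * `|s| * (d^-1 * d^-1 * d^-1).
  rewrite normrM -invfM normfV normrM mulrC ler_pdivrMr ?mulr_gt0//.
  apply: le_trans (ln_normc1D_le _ w2) _.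
  have : normc w ^+ 2 <= (`|s| * `|t| * (d^-1 * d^-1)) ^+ 2.
    by rewrite ler_pXn2r// nnegrE ?normc_ge0// !mulr_ge0// invr_ge0 ltW.
  move=> h; apply: (le_trans (ler_wpM2l _ h)) => //.
  have -> : 8 * (`|s| * `|t| * (d^-1 * d^-1)) ^+ 2 =
    8 * (`|t| * d^-1) * (`|s| * (d^-1 * d^-1 * d^-1) * (`|s| * `|t|)) by ring.
  have -> : 4 * `|s| * (d^-1 * d^-1 * d^-1) * (`|s| * `|t|) =
    4 * (`|s| * (d^-1 * d^-1 * d^-1) * (`|s| * `|t|)) by ring.
  apply: ler_wpM2r; last by lra.
  by rewrite !mulr_ge0// invr_ge0 ltW.
have bd2 : `|complex.Re (m * n / a ^+ 2 + k)|
    <= (`|s| + `|t|) * (d^-1 * d^-1 * d^-1).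
  apply: le_trans (normr_Re_le _) _; rewrite kE.
  apply: le_trans (normcD_le _ _) _.
  rewrite !normcM !normcV !normcM !normc_real m1 n1 !mul1r !invfM.
  rewrite mulrDl lerD// ler_wpM2l// !ler_pM// ?mulr_ge0// ?inv_le//.
apply: le_trans (ler_normD _ _) _; apply: le_trans (lerD bd1 bd2) _.
have dE : (d ^+ 3)^-1 = d^-1 * d^-1 * d^-1 by field; rewrite gt_eqF.
rewrite dE.
have d3 : 0 <= d^-1 * d^-1 * d^-1 by rewrite !mulr_ge0// invr_ge0 ltW.
by have := mulr_ge0 (normr_ge0 t) d3; lra.
Qed.

Lemma Re_div_lip d a a' m : 0 < d -> d <= normc a -> d <= normc a' ->
  normc m = 1 ->
  `|complex.Re (m / a) - complex.Re (m / a')| <= d ^- 2 * normc (a - a').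
Proof.
move=> d0 da da' m1.
have nz z : d <= normc z -> z != 0.
  by move=> dz; rewrite -normc_gt0; apply: lt_le_trans dz.
have a0 := nz _ da; have a0' := nz _ da'.
have inv_le z : d <= normc z -> (normc z)^-1 <= d^-1.
  by move=> dz; rewrite lef_pV2// posrE//; apply: lt_le_trans dz.
have inv_ge0 z : 0 <= (normc z)^-1 by rewrite invr_ge0 normc_ge0.
rewrite -ReB; apply: le_trans (normr_Re_le _) _.
have -> : m / a - m / a' = m * (a' - a) / (a * a').
  by field; rewrite a0 a0'.
rewrite !normcM normcV normcM m1 mul1r normc_distC mulrC invfM.
by rewrite ler_wpM2r ?normc_ge0// -exprVn expr2 ler_pM// inv_le.
Qed.

Lemma Re_div_sqr_lip d a a' m : 0 < d -> d <= normc a -> d <= normc a' ->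
  normc m = 1 ->
  `|complex.Re (m / a ^+ 2) - complex.Re (m / a' ^+ 2)|
    <= 2 * d ^- 3 * normc (a - a').
Proof.
move=> d0 da da' m1.
have nz z : d <= normc z -> z != 0.
  by move=> dz; rewrite -normc_gt0; apply: lt_le_trans dz.
have a0 := nz _ da; have a0' := nz _ da'.
have inv_le z : d <= normc z -> (normc z)^-1 <= d^-1.
  by move=> dz; rewrite lef_pV2// posrE//; apply: lt_le_trans dz.
have inv_ge0 z : 0 <= (normc z)^-1 by rewrite invr_ge0 normc_ge0.
rewrite -ReB; apply: le_trans (normr_Re_le _) _.
have -> : m / a ^+ 2 - m / a' ^+ 2 =
    m * (a' - a) * (a^-1 * a^-1 * a'^-1 + a^-1 * a'^-1 * a'^-1).
  by field; rewrite a0 a0'.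
rewrite !normcM m1 mul1r normc_distC mulrC.
rewrite ler_wpM2r ?normc_ge0//; apply: le_trans (normcD_le _ _) _.
have -> : 2 * d ^- 3 = d^-1 * d^-1 * d^-1 + d^-1 * d^-1 * d^-1.
  by field; rewrite gt_eqF.
by rewrite !normcM !normcV lerD// !ler_pM// ?mulr_ge0// ?inv_le.
Qed.

End ComplexModulus.

(** * Difference quotients and directional derivatives *)

Section DifferenceQuotients.
Context {R : realType}.
Local Open Scope complex_scope.
Implicit Types (z w m n : R[i]) (s t d C : R) (h : R[i] -> R).

Definition quot1 h m s z : R := s^-1 * (h (z + s%:C * m) - h z).

Definition quot2 h m n s t z : R :=
  s^-1 * t^-1 *
  (h (z + s%:C * m + t%:C * n) - h (z + s%:C * m) - h (z + t%:C * n) + h z).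

Definition small_step d m s z :=
  [/\ s != 0, `|s| <= d / 2, cdisk d z & cdisk d (z + s%:C * m)].

(** At [z = z'] this is a Cauchy condition as the steps shrink; in the limit of zero steps it is a
    Lipschitz bound on the derivative. *)
Definition quot1_lip d C h m := forall s s' z z',
  small_step d m s z -> small_step d m s' z' ->
  `|quot1 h m s z - quot1 h m s' z'| <= C * (normc (z - z') + `|s| + `|s'|).

(** The third condition puts the fourth corner [z + t n + s m] of the parallelogram in the disk. *)
Definition small_step2 d m n s t z :=
  [/\ small_step d m s z, small_step d n t z & small_step d m s (z + t%:C * n)].

Definition quot2_lip d C h m n := forall s t s' t' z z',
  small_step2 d m n s t z -> small_step2 d m n s' t' z' ->
  `|quot2 h m n s t z - quot2 h m n s' t' z'|
    <= C * (normc (z - z') + `|s| + `|t| + `|s'| + `|t'|).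

Definition ddir h m z : R := lim (quot1 h m s z @[s --> 0^']).

(** Used to drop the error terms proportional to a step when that step tends to 0. *)
Lemma normr_cvg_dnbhs_le (f : R -> R) l c C :
  f s @[s --> 0^'] --> l -> (\forall s \near 0^', `|f s| <= c + C * `|s|) ->
  `|l| <= c.
Proof.
move=> fl fc.
have h : (c + C * `|s|) @[s --> (0 : R)^'] --> c + C * `|0 : R|.
  apply: cvgD; first exact: cvg_cst.
  apply: cvgMr; apply: cvg_norm; exact: nbhs_dnbhs.
rewrite normr0 mulr0 addr0 in h.
exact: ler_cvg_to (cvg_norm fl) h fc.
Qed.

Lemma near_small_step d m z : normc m = 1 -> cdisk d z ->
  \forall s \near (0 : R)^', small_step d m s z.
Proof.
move=> m1 dz; have d0 : 0 < d by apply: le_lt_trans dz; exact: normc_ge0.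
have e0 : 0 < d - normc z by rewrite subr_gt0.
near=> s; split => //.
- by near: s; exact: nbhs_dnbhs_neq.
- by near: s; apply: dnbhs0_le; rewrite divr_gt0.
- rewrite /cdisk /=; apply: le_lt_trans (normcD_le _ _) _.
  rewrite normcM normc_real m1 mulr1 -ltrBrDl.
  by near: s; exact: dnbhs0_lt.
Unshelve. all: by end_near. Qed.

Section FirstOrder.
Variables (d C : R) (h : R[i] -> R) (m : R[i]).
Hypotheses (m1 : normc m = 1) (hq : quot1_lip d C h m) (C0 : 0 <= C).

Lemma quot1_cvg z : cdisk d z -> quot1 h m s z @[s --> 0^'] --> ddir h m z.
Proof.
move=> dz; apply: cauchy_cvg; apply: cauchy_exP => e e0.
(* Two steps below [e / (2 * C + 1)] make the error [C * (|s0| + |s|)] smaller than [e]; the added 1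
   covers [C = 0]. *)
have C1 : 0 < 2 * C + 1 by move: C0; lra.
have e1 : 0 < e / (2 * C + 1) by exact: divr_gt0.
near (0 : R)^' => s0.
have s0s : small_step d m s0 z by near: s0; exact: near_small_step.
have s0e : `|s0| < e / (2 * C + 1) by near: s0; exact: dnbhs0_lt.
exists (quot1 h m s0 z).
suff: \forall s \near (0 : R)^', `|quot1 h m s0 z - quot1 h m s z| < e by [].
near=> s; apply: le_lt_trans (hq _ _ _ _ s0s _) _.
  by near: s; exact: near_small_step.
have : `|s| < e / (2 * C + 1) by near: s; exact: dnbhs0_lt.
rewrite subrr (normc0 R) add0r; move: s0e.
rewrite !ltr_pdivlMr// => h1 h2.
have := normr_ge0 s; have := normr_ge0 s0; move: C0; nra.
Unshelve. all: by end_near. Qed.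

Lemma ddir_lip z z' : cdisk d z -> cdisk d z' ->
  `|ddir h m z - ddir h m z'| <= C * normc (z - z').
Proof.
move=> dz dz'.
(* The same step serves at both points, so its error is counted twice. *)
apply: (@normr_cvg_dnbhs_le (fun s => quot1 h m s z - quot1 h m s z') _ _
  (2 * C)).
  by apply: cvgB; exact: quot1_cvg.
near=> s; apply: le_trans (hq _ _ _ _ _ _) _.
- by near: s; exact: near_small_step.
- by near: s; exact: near_small_step.
- by rewrite le_eqVlt; apply/orP; left; apply/eqP; ring.
Unshelve. all: by end_near. Qed.

(** A second quotient is the quotient along [n] of first quotients along [m], and the latter
    converge at the two points involved. *)
Lemma quot2_cvg n t z : cdisk d z -> cdisk d (z + t%:C * n) ->
  quot2 h m n s t z @[s --> 0^'] --> quot1 (ddir h m) n t z.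
Proof.
move=> dz dt.
have -> : (fun s => quot2 h m n s t z) =
    (fun s => t^-1 * (quot1 h m s (z + t%:C * n) - quot1 h m s z)).
  apply/funext => s; rewrite /quot2 /quot1.
  rewrite (_ : z + t%:C * n + s%:C * m = z + s%:C * m + t%:C * n); first ring.
  by ring.
by apply: cvgMr; apply: cvgB; exact: quot1_cvg.
Qed.

(** Letting only [s] tend to 0 gives the derivative the property assumed of [h], so that the
    first-order results can be iterated. *)
Lemma ddir_quot1_lip n : normc n = 1 -> quot2_lip d C h m n ->
  quot1_lip d C (ddir h m) n.
Proof.
move=> n1 hq2 t t' z z' tz tz'.
have [_ _ dz dzt] := tz; have [_ _ dz' dzt'] := tz'.
apply: (@normr_cvg_dnbhs_le
  (fun s => quot2 h m n s t z - quot2 h m n s t' z') _ _ (2 * C)).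
  by apply: cvgB; exact: quot2_cvg.
near=> s; apply: le_trans (hq2 _ _ _ _ _ _ _ _) _.
- by split => //; near: s; exact: near_small_step.
- by split => //; near: s; exact: near_small_step.
- by rewrite le_eqVlt; apply/orP; left; apply/eqP; ring.
Unshelve. all: by end_near. Qed.

End FirstOrder.

End DifferenceQuotients.

(** * From bounds on quotients to harmonicity in real coordinates *)

Section Harmonicity.
Context {R : realType}.
Local Open Scope complex_scope.
Implicit Types (z : R[i]) (p q : R * R) (d C : R) (h : R[i] -> R).

Local Notation coords h := (fun p => h (p.1 +i* p.2)).

Lemma normc_i : normc ('i : R[i]) = 1.
Proof. by rewrite /normc /= expr0n expr1n add0r sqrtr1. Qed.

Lemma normc_complex_le (x y : R) : normc (x +i* y) <= `|x| + `|y|.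
Proof.
have -> : x +i* y = x%:C + y%:C * 'i by apply/eqP; rewrite eq_complex /=;
  apply/andP; split; apply/eqP; ring.
apply: le_trans (normcD_le _ _) _.
by rewrite normcM !normc_real normc_i mulr1.
Qed.

Lemma dx_quotE h p (s : R) :
  s^-1 *: ((coords h \o shift p) (s *: ((1, 0) : R * R)) - h (p.1 +i* p.2)) =
  quot1 h 1 s (p.1 +i* p.2).
Proof.
rewrite /quot1 /= /GRing.scale /=; congr (_ * (h _ - _)).
by apply/eqP; rewrite eq_complex /=; apply/andP; split; apply/eqP; ring.
Qed.

Lemma dy_quotE h p (s : R) :
  s^-1 *: ((coords h \o shift p) (s *: ((0, 1) : R * R)) - h (p.1 +i* p.2)) =
  quot1 h 'i s (p.1 +i* p.2).
Proof.
rewrite /quot1 /= /GRing.scale /=; congr (_ * (h _ - _)).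
by apply/eqP; rewrite eq_complex /=; apply/andP; split; apply/eqP; ring.
Qed.

Lemma dxE h : dx (coords h) = coords (ddir h 1).
Proof.
apply/funext => p; rewrite /dx /derive /ddir.
rewrite (_ : (fun _ => _) = (fun s => quot1 h 1 s (p.1 +i* p.2)))//.
by apply/funext => s; exact: dx_quotE.
Qed.

Lemma dyE h : dy (coords h) = coords (ddir h 'i).
Proof.
apply/funext => p; rewrite /dy /derive /ddir.
rewrite (_ : (fun _ => _) = (fun s => quot1 h 'i s (p.1 +i* p.2)))//.
by apply/funext => s; exact: dy_quotE.
Qed.

Lemma coords_continuous d C h p :
  (forall z z', cdisk d z -> cdisk d z' ->
    `|h z - h z'| <= C * normc (z - z')) ->
  0 <= C -> cdisk d (p.1 +i* p.2) -> {for p, continuous (coords h)}.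
Proof.
move=> hl C0 dp; apply/cvgrPdist_le => e e0.
have C1 : 0 < 2 * C + 1 by move: C0; lra.
have e1 : 0 < e / (2 * C + 1) by exact: divr_gt0.
have r0 : 0 < d - normc (p.1 +i* p.2) by rewrite subr_gt0.
(* Each coordinate may move by half the distance to the boundary circle, which keeps [q] in the
   disk. *)
have r1 : 0 < (d - normc (p.1 +i* p.2)) / 2 by exact: divr_gt0.
have fst1 r : 0 < r -> \forall q \near p, `|p.1 - q.1| < r.
  move=> r_gt0; have fp : (fst @ nbhs p --> p.1) by exact: cvg_fst.
  by move/cvgrPdist_lt: fp => /(_ _ r_gt0).
have snd1 r : 0 < r -> \forall q \near p, `|p.2 - q.2| < r.
  move=> r_gt0; have fp : (snd @ nbhs p --> p.2) by exact: cvg_snd.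
  by move/cvgrPdist_lt: fp => /(_ _ r_gt0).
near=> q.
have qp : normc ((p.1 +i* p.2) - (q.1 +i* q.2)) <= `|p.1 - q.1| + `|p.2 - q.2|.
  exact: normc_complex_le.
have dq : cdisk d (q.1 +i* q.2).
  have := normcD_le ((q.1 +i* q.2) - (p.1 +i* p.2)) (p.1 +i* p.2).
  rewrite subrK normc_distC => tri; change (normc (q.1 +i* q.2) < d).
  have : `|p.1 - q.1| < (d - normc (p.1 +i* p.2)) / 2.
    by near: q; exact: fst1.
  have : `|p.2 - q.2| < (d - normc (p.1 +i* p.2)) / 2.
    by near: q; exact: snd1.
  by move: qp tri; lra.
apply: le_trans (hl _ _ dp dq) _.
apply: le_trans (ler_wpM2l C0 qp) _.
have : `|p.1 - q.1| < e / (2 * C + 1) by near: q; exact: fst1.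
have : `|p.2 - q.2| < e / (2 * C + 1) by near: q; exact: snd1.
rewrite !ltr_pdivlMr//.
have := normr_ge0 (p.1 - q.1); have := normr_ge0 (p.2 - q.2); move: C0; nra.
Unshelve. all: by end_near. Qed.

Lemma C1_on_coords d C h : 0 <= C ->
  (forall m, normc m = 1 -> quot1_lip d C h m) ->
  C1_on [set p | cdisk d (p.1 +i* p.2)] (coords h).
Proof.
move=> C0 hq p dp; have n1 : normc (1 : R[i]) = 1 := normc1 R.
split.
- rewrite /derivable (_ : (fun _ => _) = (fun s => quot1 h 1 s (p.1 +i* p.2))).
    by apply: cvgP; exact: (quot1_cvg _ _ _ _ n1 (hq _ n1)).
  by apply/funext => s; exact: dx_quotE.
- rewrite /derivable (_ : (fun _ => _) = (fun s => quot1 h 'i s (p.1 +i* p.2))).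
    by apply: cvgP; exact: (quot1_cvg _ _ _ _ normc_i (hq _ normc_i)).
  by apply/funext => s; exact: dy_quotE.
- rewrite dxE; apply: (coords_continuous d C) dp => // z z'.
  exact: (ddir_lip d C _ _ n1 (hq _ n1) C0 z z').
- rewrite dyE; apply: (coords_continuous d C) dp => // z z'.
  exact: (ddir_lip d C _ _ normc_i (hq _ normc_i) C0 z z').
Qed.

(** [C1_on_coords] applied to [h] and to its two partial derivatives gives class C^2; the last
    hypothesis says that the discrete Laplacian vanishes with the steps. *)
Lemma harmonic_on_disk d C h : 0 <= C ->
  (forall m, normc m = 1 -> quot1_lip d C h m) ->
  (forall m n, normc m = 1 -> normc n = 1 -> quot2_lip d C h m n) ->
  (forall s t z, small_step2 d 1 1 s t z -> small_step2 d 'i 'i s t z ->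
    `|quot2 h 1 1 s t z + quot2 h 'i 'i s t z| <= C * (`|s| + `|t|)) ->
  harmonic_on (cdisk d) h.
Proof.
move=> C0 h1 h2 h3; have n1 : normc (1 : R[i]) = 1 := normc1 R.
have dh1 m : normc m = 1 -> forall n, normc n = 1 -> quot1_lip d C (ddir h m) n.
  move=> m1 n n1'.
  exact: (ddir_quot1_lip d C h m m1 (h1 _ m1) C0 n n1' (h2 _ _ m1 n1')).
split.
  split; first exact: (C1_on_coords d C).
  - by rewrite dxE; apply: (C1_on_coords d C) => //; exact: dh1.
  - by rewrite dyE; apply: (C1_on_coords d C) => //; apply: dh1; exact: normc_i.
move=> p dp; rewrite !dxE !dyE; set z := _ +i* _.
have cvg1 m : normc m = 1 ->
    quot1 (ddir h m) m t z @[t --> 0^'] --> ddir (ddir h m) m z.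
  by move=> m1; exact: (quot1_cvg _ _ _ _ m1 (dh1 _ m1 _ m1) C0).
apply/eqP; rewrite -normr_le0.
(* The outer limit is in [t]; for fixed [t] the inner limit in [s] brings the claim back to second
   quotients of [h]. *)
apply: (@normr_cvg_dnbhs_le _ (fun t => quot1 (ddir h 1) 1 t z +
    quot1 (ddir h 'i) 'i t z) _ _ C).
  by apply: cvgD; apply: cvg1 => //; exact: normc_i.
near=> t.
have t1 : small_step d 1 t z by near: t; exact: near_small_step.
have ti : small_step d 'i t z.
  by near: t; apply: near_small_step => //; exact: normc_i.
have [_ _ _ dt1] := t1; have [_ _ _ dti] := ti.
apply: (@normr_cvg_dnbhs_le _ (fun s => quot2 h 1 1 s t z +
    quot2 h 'i 'i s t z) _ _ C).
  by apply: cvgD; [apply: (quot2_cvg _ _ _ _ n1 (h1 _ n1))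
                  |apply: (quot2_cvg _ _ _ _ normc_i (h1 _ normc_i))].
near=> s.
rewrite add0r (_ : C * `|t| + C * `|s| = C * (`|s| + `|t|)); last by ring.
apply: h3.
- by split => //; near: s; exact: near_small_step.
- by split => //; near: s; apply: near_small_step => //; exact: normc_i.
Unshelve. all: by end_near. Qed.

End Harmonicity.

(** * Averages of logarithmic potentials *)

Section MeanPotentials.
Context {R : realType}.
Local Open Scope complex_scope.
Implicit Types (z a m n : R[i]) (s t d B : R) (h : R[i] -> R)
  (S : seq (R * R[i])).

(** [S] stands for a finitely supported signed measure, given by weights and points, against which
    [h] is integrated. *)
Definition lincomb S h : R := \sum_(x <- S) x.1 * h x.2.

Definition in_disk d S := all (fun x => normc x.2 < d) S.

Definition log_potential a z : R := ln (normc (z - a)).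

(* A function on the disk of radius d has this property when it is a limit of
   sums of a constant and a subaverage of the potentials of the points at
   distance at least 2d from 0; the dual formulation makes it visibly stable
   under pointwise limits and expectations. *)
Definition mean_potential d h := forall S B,
  in_disk d S -> \sum_(x <- S) x.1 = 0 ->
  (forall a, 2 * d <= normc a -> `|lincomb S (log_potential a)| <= B) ->
  `|lincomb S h| <= B.

Lemma eq_lincomb d S h h' : in_disk d S ->
  (forall z, normc z < d -> h z = h' z) -> lincomb S h = lincomb S h'.
Proof.
rewrite /lincomb; elim: S => [|x S ih] /=; first by rewrite !big_nil.
by move=> /andP[dx dS] hh; rewrite !big_cons ih// hh.
Qed.

Lemma lincombZ S (c : R) h : lincomb S (fun z => c * h z) = c * lincomb S h.
Proof.
by rewrite /lincomb big_distrr; apply: eq_bigr => x _; rewrite mulrCA.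
Qed.

Lemma lincombD S h h' : lincomb S (fun z => h z + h' z) =
  lincomb S h + lincomb S h'.
Proof.
by rewrite /lincomb -big_split; apply: eq_bigr => x _; rewrite mulrDr.
Qed.

Lemma lincomb_cst S (c : R) : lincomb S (fun=> c) = (\sum_(x <- S) x.1) * c.
Proof. by rewrite /lincomb big_distrl. Qed.

Lemma lincomb_sum S (I : Type) (r : seq I) (F : I -> R[i] -> R) :
  lincomb S (fun z => \sum_(i <- r) F i z) = \sum_(i <- r) lincomb S (F i).
Proof.
rewrite /lincomb exchange_big; apply: eq_bigr => x _.
by rewrite big_distrr.
Qed.

Lemma normc_sub_ge d z a : normc z < d -> 2 * d <= normc a ->
  d <= normc (z - a).
Proof.
move=> zd ad; have := normcB_ge a (- z).
by rewrite normcN_eq normc_distC; lra.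
Qed.

Lemma log_potential_quot1 d a m s z : 2 * d <= normc a -> normc m = 1 ->
  small_step d m s z ->
  `|quot1 (log_potential a) m s z - complex.Re (m / (z - a))|
    <= 8 / d ^+ 2 * `|s|.
Proof.
move=> ad m1 [s0 sd dz _].
have d0 : 0 < d by apply: le_lt_trans dz; exact: normc_ge0.
rewrite /quot1 /log_potential addrAC.
by apply: ln_normcD_quot_le => //; exact: normc_sub_ge.
Qed.

Lemma log_potential_quot2 d a m n s t z : 2 * d <= normc a ->
  normc m = 1 -> normc n = 1 -> small_step2 d m n s t z ->
  `|quot2 (log_potential a) m n s t z + complex.Re (m * n / (z - a) ^+ 2)|
    <= 5 / d ^+ 3 * (`|s| + `|t|).
Proof.
move=> ad m1 n1 [[s0 sd dz dzs] [t0 td _ dzt] [_ _ _ dst]].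
have d0 : 0 < d by apply: le_lt_trans dz; exact: normc_ge0.
rewrite /quot2 /log_potential.
rewrite (_ : z + s%:C * m + t%:C * n - a = z - a + s%:C * m + t%:C * n);
  last by ring.
rewrite !(addrAC z _ (- a)).
apply: ln_normcD_quot2_le => //; rewrite ?(addrAC _ (- a)).
- exact: normc_sub_ge.
- exact: normc_sub_ge.
- exact: normc_sub_ge.
rewrite -normc_gt0; apply: lt_le_trans d0 _.
by rewrite (addrAC z); exact: normc_sub_ge.
Qed.

Section Consequences.
Variables (d : R) (h : R[i] -> R).
Hypotheses (d0 : 0 < d) (mh : mean_potential d h).

(** One constant for three estimates: the first term covers the first quotients, the second covers
    the second quotients, its 10 being twice the 5 of [log_potential_quot2] for the sum of two of
    them in the Laplacian. *)
Let C := 8 / d ^+ 2 + 10 / d ^+ 3.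

(** The difference of two quotients is a combination of four point evaluations with total weight
    zero, so it is enough to bound it on each potential, where both quotients are close to
    [Re (m / (z - a))] and [Re (m / (z' - a))]. *)
Lemma mean_potential_quot1 m : normc m = 1 -> quot1_lip d C h m.
Proof.
move=> m1 s s' z z' sz sz'.
pose S := [:: (s^-1, z + s%:C * m); (- s^-1, z);
  (- s'^-1, z' + s'%:C * m); (s'^-1, z')].
have SE k : lincomb S k = quot1 k m s z - quot1 k m s' z'.
  by rewrite /lincomb !big_cons big_nil /quot1 /=; ring.
have [_ _ dz dzs] := sz; have [_ _ dz' dzs'] := sz'.
rewrite -SE; apply: mh.
- by rewrite /in_disk /= dz dzs dz' dzs'.
- by rewrite !big_cons big_nil /=; ring.
move=> a ad; rewrite SE.
have h1 := log_potential_quot1 d a m s z ad m1 sz.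
have h2 := log_potential_quot1 d a m s' z' ad m1 sz'.
have := Re_div_lip d (z - a) (z' - a) m d0 (normc_sub_ge _ _ _ dz ad)
  (normc_sub_ge _ _ _ dz' ad) m1.
rewrite (_ : z - a - (z' - a) = z - z'); last by ring.
move: h1 h2; rewrite /C.
set e1 := 8 / _; set e2 := d ^- 2; set e3 := d ^- 3.
have i2 : 0 <= e2 by rewrite invr_ge0 exprn_ge0// ltW.
have i3 : 0 <= e3 by rewrite invr_ge0 exprn_ge0// ltW.
have e1E : e1 = 8 * e2 by [].
have N0 := normc_ge0 (z - z'); have S0 := normr_ge0 s.
have S0' := normr_ge0 s'.
rewrite e1E !ler_norml => /andP[a1 a2] /andP[b1 b2] /andP[c1 c2].
have := mulr_ge0 i2 N0; have := mulr_ge0 i2 S0; have := mulr_ge0 i2 S0'.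
have := mulr_ge0 i3 N0; have := mulr_ge0 i3 S0; have := mulr_ge0 i3 S0'.
by move=> *; apply/andP; split; lra.
Qed.

Lemma mean_potential_quot2 m n : normc m = 1 -> normc n = 1 ->
  quot2_lip d C h m n.
Proof.
move=> m1 n1 s t s' t' z z' sz sz'.
pose q := s^-1 * t^-1; pose q' := s'^-1 * t'^-1.
pose S := [:: (q, z + s%:C * m + t%:C * n); (- q, z + s%:C * m);
  (- q, z + t%:C * n); (q, z); (- q', z' + s'%:C * m + t'%:C * n);
  (q', z' + s'%:C * m); (q', z' + t'%:C * n); (- q', z')].
have SE k : lincomb S k = quot2 k m n s t z - quot2 k m n s' t' z'.
  by rewrite /lincomb !big_cons big_nil /quot2 -/q -/q' /=; ring.
have [[_ _ dz dzs] [_ _ _ dzt] [_ _ _ dst]] := sz.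
have [[_ _ dz' dzs'] [_ _ _ dzt'] [_ _ _ dst']] := sz'.
rewrite addrAC in dst; rewrite addrAC in dst'.
rewrite -SE; apply: mh.
- by rewrite /in_disk /= dz dzs dz' dzs' dzt dzt' dst dst'.
- by rewrite !big_cons big_nil /=; ring.
move=> a ad; rewrite SE.
have h1 := log_potential_quot2 d a m n s t z ad m1 n1 sz.
have h2 := log_potential_quot2 d a m n s' t' z' ad m1 n1 sz'.
have mn1 : normc (m * n) = 1 by rewrite normcM m1 n1 mulr1.
have := Re_div_sqr_lip d (z - a) (z' - a) (m * n) d0 (normc_sub_ge _ _ _ dz ad)
  (normc_sub_ge _ _ _ dz' ad) mn1.
rewrite (_ : z - a - (z' - a) = z - z'); last by ring.
move: h1 h2; rewrite /C.
set e1 := 8 / _; set e2 := 5 / _; set e3 := d ^- 3.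
have i1 : 0 <= e1 by rewrite divr_ge0// exprn_ge0// ltW.
have i3 : 0 <= e3 by rewrite invr_ge0 exprn_ge0// ltW.
have e2E : e2 = 5 * e3 by [].
have N0 := normc_ge0 (z - z'); have S0 := normr_ge0 s.
have S0' := normr_ge0 s'; have T0 := normr_ge0 t; have T0' := normr_ge0 t'.
rewrite e2E !ler_norml => /andP[a1 a2] /andP[b1 b2] /andP[c1 c2].
have := mulr_ge0 i1 N0; have := mulr_ge0 i1 S0; have := mulr_ge0 i1 S0'.
have := mulr_ge0 i1 T0; have := mulr_ge0 i1 T0'.
have := mulr_ge0 i3 N0; have := mulr_ge0 i3 S0; have := mulr_ge0 i3 S0'.
have := mulr_ge0 i3 T0; have := mulr_ge0 i3 T0'.
by move=> *; apply/andP; split; lra.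
Qed.

(** On a potential the main terms along 1 and ['i] are opposite because ['i * 'i = -1]; only the
    errors proportional to the steps remain. *)
Lemma mean_potential_laplace s t z :
  small_step2 d 1 1 s t z -> small_step2 d 'i 'i s t z ->
  `|quot2 h 1 1 s t z + quot2 h 'i 'i s t z| <= C * (`|s| + `|t|).
Proof.
move=> sz sz'.
pose q := s^-1 * t^-1.
pose S := [:: (q, z + s%:C * 1 + t%:C * 1); (- q, z + s%:C * 1);
  (- q, z + t%:C * 1); (q, z); (q, z + s%:C * 'i + t%:C * 'i);
  (- q, z + s%:C * 'i); (- q, z + t%:C * 'i); (q, z)].
have SE k : lincomb S k = quot2 k 1 1 s t z + quot2 k 'i 'i s t z.
  by rewrite /lincomb !big_cons big_nil /quot2 -/q /=; ring.
have [[_ _ dz dzs] [_ _ _ dzt] [_ _ _ dst]] := sz.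
have [[_ _ _ dzs'] [_ _ _ dzt'] [_ _ _ dst']] := sz'.
rewrite addrAC in dst; rewrite addrAC in dst'.
rewrite -SE; apply: mh.
- by rewrite /in_disk /= dz dzs dzs' dzt dzt' dst dst'.
- by rewrite !big_cons big_nil /=; ring.
move=> a ad; rewrite SE.
have n1 : normc (1 : R[i]) = 1 := normc1 R.
have h1 := log_potential_quot2 d a 1 1 s t z ad n1 n1 sz.
have h2 := log_potential_quot2 d a 'i 'i s t z ad normc_i normc_i sz'.
have ii : 'i * 'i = - (1 : R[i]) by rewrite -expr2 sqr_i.
have Ri : complex.Re ('i * 'i / (z - a) ^+ 2) =
    - complex.Re (1 * 1 / (z - a) ^+ 2).
  by rewrite ii mulNr mulr1; case: (_ / _).
move: h1 h2; rewrite Ri /C.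
set e1 := 8 / _; set e2 := 5 / _; set e3 := 10 / _.
have i1 : 0 <= e1 by rewrite divr_ge0// exprn_ge0// ltW.
have e2E : e3 = 2 * e2 by rewrite /e3 /e2 mulrA; congr (_ / _); ring.
have S0 := normr_ge0 s; have T0 := normr_ge0 t.
rewrite e2E !ler_norml => /andP[a1 a2] /andP[b1 b2].
have := mulr_ge0 i1 S0; have := mulr_ge0 i1 T0.
by move=> *; apply/andP; split; lra.
Qed.

Lemma mean_potential_harmonic : harmonic_on (cdisk d) h.
Proof.
apply: (@harmonic_on_disk _ d C).
- by rewrite addr_ge0// divr_ge0// exprn_ge0// ltW.
- exact: mean_potential_quot1.
- exact: mean_potential_quot2.
- exact: mean_potential_laplace.
Qed.

End Consequences.

(** A combination involves finitely many points, so pointwise convergence is enough. *)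
Lemma mean_potential_lim d (f : nat -> R[i] -> R) h :
  (forall k, mean_potential d (f k)) ->
  (forall z, normc z < d -> f k z @[k --> \oo] --> h z) ->
  mean_potential d h.
Proof.
move=> mf fh S B dS S0 SB.
have cS : lincomb S (f k) @[k --> \oo] --> lincomb S h.
  elim: S dS {S0 SB} => [|x S ih] /=.
    move=> _; rewrite /lincomb big_nil; under eq_fun do rewrite big_nil.
    exact: cvg_cst.
  move=> /andP[dx dS]; rewrite /lincomb big_cons.
  under eq_fun do rewrite big_cons.
  by apply: cvgD; [apply: cvgMr; exact: fh|exact: ih].
apply: (cvgr_to_le (cvg_norm cS)).
by near=> k; exact: mf.
Unshelve. all: by end_near. Qed.

(** Splitting [p] over its roots makes [ln |p|] a constant plus at most [k] potentials of points
    outside the disk of radius [2 d]; the zero total weight kills the constant and [k^-1]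
    compensates the number of roots. *)
Lemma mean_potential_poly d (p : {poly R[i]}) k : 0 < d -> (0 < k)%N ->
  (size p <= k.+1)%N -> (forall z, normc z < 2 * d -> p.[z] != 0) ->
  mean_potential d (fun z => k%:R^-1 * ln (normc p.[z])).
Proof.
move=> d0 k0 sp pn S B dS S0 SB.
have [r pE] := closed_field_poly_normal p.
have p0 : p != 0.
  apply: contra (pn 0 _) => [/eqP->|]; first by rewrite horner0.
  by rewrite (normc0 R); lra.
have l0 : lead_coef p != 0 by rewrite lead_coef_eq0.
have rd a : a \in r -> 2 * d <= normc a.
  move=> ar; rewrite leNgt; apply/negP => /pn; rewrite pE hornerZ.
  by rewrite mulf_eq0 negb_or => /andP[_]; rewrite -rootE root_prod_XsubC ar.
have sr : (size r <= k)%N.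
  by move: sp; rewrite pE size_scale// size_prod_XsubC ltnS.
have hE z : normc z < d ->
    k%:R^-1 * ln (normc p.[z]) = k%:R^-1 * (ln (normc (lead_coef p)) +
      \sum_(a <- r) log_potential a z).
  move=> zd; congr (_ * _).
  rewrite {1}pE hornerZ horner_prod.
  under eq_bigr do rewrite hornerXsubC.
  elim: r rd {pE sr} => [|a r ih] rd.
    by rewrite !big_nil mulr1 addr0.
  have za b : b \in a :: r -> z - b != 0.
    move=> /rd bd; rewrite -normc_gt0; apply: lt_le_trans d0 _.
    exact: normc_sub_ge.
  rewrite !big_cons mulrCA ln_normcM.
  - rewrite ih; first by rewrite /log_potential addrCA.
    by move=> b br; apply: rd; rewrite inE br orbT.
  - by apply: za; rewrite mem_head.
  - rewrite mulf_neq0// prodf_seq_neq0; apply/allP => b br.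
    by apply: za; rewrite inE br orbT.
rewrite (eq_lincomb d S _ _ dS hE) lincombZ lincombD lincomb_cst S0 mul0r add0r.
rewrite lincomb_sum normrM normfV normr_nat ler_pdivrMl ?ltr0n//.
(* Positivity of [B], read off the potential of the point [2 d], covers the case of fewer than [k]
   roots. *)
have B0 : 0 <= B.
  by apply: le_trans (SB (2 * d)%:C _); rewrite // normc_real ler_norm.
apply: le_trans (ler_norm_sum _ _ _) _.
apply: (@le_trans _ _ (\sum_(a <- r) B)).
  by rewrite big_seq [leRHS]big_seq; apply: ler_sum => a ar; apply/SB/rd.
rewrite big_const_seq count_predT iter_addr_0 -[B *+ _]mulr_natl ler_wpM2r//.
by rewrite ler_nat.
Qed.

(** Finite combinations commute with the integral, and total mass one preserves the bound [B]. *)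
Lemma mean_potential_mean d (dT : measure_display) (T : measurableType dT)
    (P : probability T R) (H : T -> R[i] -> R) :
  (forall w, mean_potential d (H w)) ->
  (forall z, normc z < d -> P.-integrable setT (fun w => (H w z)%:E)) ->
  mean_potential d (fun z => \int[P]_(w in setT) H w z).
Proof.
move=> mH iH S B dS S0 SB.
have [iS ->] : P.-integrable setT (fun w => (lincomb S (H w))%:E) /\
    lincomb S (fun z => \int[P]_(w in setT) H w z) =
    \int[P]_(w in setT) lincomb S (H w).
  elim: S dS {S0 SB} => [|x S ih] /=.
    move=> _; rewrite /lincomb big_nil; under eq_fun do rewrite big_nil.
    under [in RHS]eq_fun do rewrite big_nil.
    split; first exact: integrable0.
    by rewrite Rintegral_cst// mul0r.
  move=> /andP[dx dS]; have [iS SE] := ih dS.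
  have ix : P.-integrable setT (fun w => (x.1 * H w x.2)%:E).
    by under eq_fun do rewrite EFinM; apply: integrableZl => //; exact: iH.
  rewrite /lincomb big_cons -/(lincomb S _).
  under eq_fun do rewrite big_cons EFinD.
  under [in RHS]eq_fun do rewrite big_cons.
  split; first exact: integrableD.
  by rewrite RintegralD// RintegralZl//; [congr (_ + _); exact: SE|exact: iH].
apply: le_trans (le_normr_Rintegral _ _) _ => //.
apply: (@le_trans _ _ (\int[P]_(w in setT) B)).
  apply: le_Rintegral => //.
  - exact: integrable_norm.
  - exact: finite_measure_integrable_cst.
  - by move=> w _; apply: mH.
by rewrite Rintegral_cst// [X in fine X]probability_setT mulr1.
Qed.

End MeanPotentials.

(** * Uniform escape of random orbits and convergence to the Green function *)

Section RandomOrbits.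
Context {R : realType}.
Local Open Scope complex_scope.
Implicit Types (z c lambda : R[i]) (w : nat -> udisk R) (d M : R).

Lemma not_mandelbrot_escape c0 M : ~ mandelbrot c0 ->
  exists n, M < normc (iter n (quad c0) 0).
Proof.
move=> hc; apply: contrapT => /forallNP hn; apply: hc.
by exists M => n; rewrite leNgt; apply/negP/hn.
Qed.

(** [K] is chosen before [w]: this uniformity lets a single escape time and a single radius serve
    all noise sequences. *)
Lemma random_orbit_near c0 n : exists2 K : R, 0 <= K &
  forall lambda w, normc lambda <= 1 ->
    normc (random_orbit c0 lambda w n 0 - iter n (quad c0) 0)
      <= K * normc lambda.
Proof.
elim: n => [|n [K K0 ih]].
  by exists 0 => // lambda w _; rewrite mul0r [X in normc X]subrr (normc0 R).
set z0 := iter n (quad c0) 0 in ih.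
(* For [|lambda| <= 1] the factor [z + z0] is at most [K + 2 |z0|]; the final 1 accounts for the
   noise [lambda * v], where [|v| < 1]. *)
exists (K * (K + 2 * normc z0) + 1).
  by rewrite addr_ge0// mulr_ge0// addr_ge0// mulr_ge0// normc_ge0.
move=> lambda w l1; rewrite iterS -/z0 /= /quad.
set z := random_orbit c0 lambda w n 0.
have zz0 : normc (z - z0) <= K * normc lambda := ih lambda w l1.
have v1 : normc (udisk_val (w n)) < 1 := svalP (w n).
have l0 := normc_ge0 lambda.
have -> : z ^+ 2 + (c0 + lambda * udisk_val (w n)) - (z0 ^+ 2 + c0) =
    (z - z0) * (z - z0 + z0 + z0) + lambda * udisk_val (w n) by ring.
apply: le_trans (normcD_le _ _) _.
rewrite [leRHS]mulrDl mul1r lerD//; last first.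
  by rewrite normcM ler_piMr// ltW.
rewrite normcM mulrAC ler_pM ?normc_ge0//.
apply: le_trans (normcD_le _ _) _.
apply: le_trans (lerD (normcD_le _ _) (lexx _)) _.
have : K * normc lambda <= K by rewrite ler_piMr.
move: zz0; lra.
Qed.

(** Here [|z| (|z| - 2) >= |c0| + 1 >= |c|], which gives the lower bound; the upper one follows from
    [|c| <= |z|^2]. *)
Lemma normc_quad_bounds c0 c z : normc c <= normc c0 + 1 ->
  normc c0 + 3 <= normc z ->
  2 * normc z <= normc (quad c z) <= 2 * normc z ^+ 2.
Proof.
move=> hc hz; have c0' := normc_ge0 c0.
have := normcB_ge (z ^+ 2) c; have := normcD_le (z ^+ 2) c.
by rewrite normcX -/(quad c z) => h1 h2; apply/andP; split; nra.
Qed.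

Section Escape.
Variables (c0 lambda : R[i]) (w : nat -> udisk R) (N : nat).
Hypotheses (l1 : normc lambda <= 1)
  (hN : normc c0 + 3 <= normc (random_orbit c0 lambda w N 0)).

Local Notation z k := (random_orbit c0 lambda w (k + N) 0).

Lemma normc_param_le v : normc (c0 + lambda * udisk_val v) <= normc c0 + 1.
Proof.
apply: le_trans (normcD_le _ _) _; rewrite lerD2l normcM.
by rewrite mulr_ile1 ?normc_ge0//; apply: ltW; exact: svalP v.
Qed.

Lemma normc_orbit_ge k : normc c0 + 3 + k%:R <= normc (z k).
Proof.
elim: k => [|k ih]; first by rewrite addr0.
have c0' := normc_ge0 c0.
have hk : normc c0 + 3 <= normc (z k).
  by apply: le_trans ih; rewrite lerDl.
have := normc_quad_bounds c0 _ _ (normc_param_le (w (k + N)%N)) hk.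
rewrite addSn /= => /andP[h _]; apply: le_trans h; rewrite -natr1.
by move: ih hk; lra.
Qed.

Lemma orbit_escapes k : normc c0 + 3 <= normc (z k).
Proof. by apply: le_trans (normc_orbit_ge k); rewrite lerDl. Qed.

Lemma orbit_in_basin : basin c0 lambda w 0.
Proof.
rewrite /basin /= -(cvg_shiftn N); apply/cvgryPger => A _.
near=> k; apply: le_trans (normc_orbit_ge k).
have : A <= k%:R by near: k; exact: nbhs_infty_ger.
by have := normc_ge0 c0; lra.
Unshelve. all: by end_near. Qed.

Let a k : R := 2 ^- (k + N) * ln (normc (z k)).
(* One step changes [a] by at most [2 ^- (k + N).+1]; adding [2 ^- (k + N)]
   makes the sequence nonincreasing. *)
Let b k : R := a k + 2 ^- (k + N).

Let a_ge0 k : 0 <= a k.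
Proof.
rewrite mulr_ge0 ?invr_ge0 ?exprn_ge0// ln_ge0//.
by apply: le_trans (orbit_escapes k); have := normc_ge0 c0; lra.
Qed.

Let b_nonincreasing : nonincreasing_seq b.
Proof.
apply/nonincreasing_seqP => k.
have zk := orbit_escapes k.
have z0 : 0 < normc (z k) by apply: lt_le_trans zk; have := normc_ge0 c0; lra.
have /andP[lo up] := normc_quad_bounds c0 _ _ (normc_param_le (w (k + N)%N)) zk.
have ln2 : ln (2 : R) <= 1 by have := @le_ln1Dx R 1; apply; lra.
(* After division by [2 ^+ (k + N).+1] the 1 becomes [2 ^- (k + N).+1], exactly the decrease of the
   correction term in [b]. *)
have : ln (normc (z k.+1)) <= 1 + 2 * ln (normc (z k)).
  apply: (@le_trans _ _ (ln (2 * normc (z k) ^+ 2))).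
    rewrite ler_ln ?posrE ?mulr_gt0 ?exprn_gt0//.
    by apply: lt_le_trans lo; rewrite mulr_gt0.
  by rewrite lnM ?posrE ?exprn_gt0// lnXn// [ln _ *+ 2]mulr2n; lra.
rewrite /b /a addSn exprS invfM.
set e := 2 ^- (k + N); set x := ln _; set y := ln _ => h.
have e0 : 0 < e by rewrite invr_gt0 exprn_gt0.
by nra.
Qed.

(** [b] is nonincreasing and nonnegative, hence convergent, and differs from [a] by a null sequence;
    [orbit_in_basin] selects the branch of [green] that is this limit. *)
Lemma green_cvg : a k @[k --> \oo] --> green c0 lambda w 0.
Proof.
have bl : has_lbound (range b).
  exists 0 => _ [k _ <-]; rewrite /b addr_ge0// invr_ge0 exprn_ge0//.
have cb := nonincreasing_is_cvgn b_nonincreasing bl.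
have c2 : (2 ^- (k + N) : R) @[k --> \oo] --> (0 : R).
  rewrite (cvg_shiftn N (fun k => 2 ^- k : R)).
  under eq_fun do rewrite -exprVn.
  by apply: cvg_expr; rewrite ger0_norm; lra.
have ca : cvg (a k @[k --> \oo]).
  rewrite (_ : a = (fun k => b k - 2 ^- (k + N))).
    by apply: is_cvgB => //; apply: cvgP c2.
  by apply/funext => k; rewrite /b addrK.
rewrite /green mem_set; last exact: orbit_in_basin.
have /cvg_ex[l al] := ca.
suff -> : lim (2 ^- n * ln (normc (random_orbit c0 lambda w n 0))
    @[n --> \oo]) = l by [].
by apply: cvg_lim => //; rewrite -(cvg_shiftn N).
Qed.

(** The upper bound is the initial value of [b]; it provides a domination by data at time [N]
    only. *)
Lemma green_bounds : 0 <= green c0 lambda w 0 <= a 0 + 2 ^- N.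
Proof.
have bl : has_lbound (range b).
  by exists 0 => _ [k _ <-]; rewrite /b addr_ge0// invr_ge0 exprn_ge0.
have cb := nonincreasing_is_cvgn b_nonincreasing bl.
apply/andP; split.
  by apply: (cvgr_to_ge green_cvg); near=> k; exact: a_ge0.
apply: (cvgr_to_le green_cvg); near=> k.
apply: (@le_trans _ _ (b k)).
  by rewrite /b lerDl invr_ge0 exprn_ge0.
by have := b_nonincreasing 0%N k (leq0n k).
Unshelve. all: by end_near. Qed.

End Escape.

(** The indeterminate is the parameter [lambda]; the starting point is fixed at 0. *)
Fixpoint orbit_poly c0 w n : {poly R[i]} :=
  if n is m.+1
  then orbit_poly c0 w m ^+ 2 + (c0%:P + udisk_val (w m) *: 'X)
  else 0.

Lemma horner_orbit_poly c0 w n lambda :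
  (orbit_poly c0 w n).[lambda] = random_orbit c0 lambda w n 0.
Proof.
elim: n => [|n ih] /=; first by rewrite horner0.
by rewrite !hornerD horner_exp hornerC hornerZ hornerX ih /quad (mulrC lambda).
Qed.

Lemma size_orbit_poly c0 w n : (size (orbit_poly c0 w n) <= (2 ^ n).+1)%N.
Proof.
elim: n => [|n ih] /=; first by rewrite size_poly0.
apply: leq_trans (size_polyD _ _) _; rewrite geq_max; apply/andP; split.
  rewrite expr2; apply: leq_trans (size_polyMleq _ _) _.
  rewrite expnS mul2n -addnn -subn1 leq_subLR.
  by apply: leq_trans (leq_add ih ih) _; rewrite addSn addnS.
apply: leq_trans (size_polyD _ _) _; rewrite geq_max; apply/andP; split.
  by apply: leq_trans (size_polyC_leq1 _) _.
apply: leq_trans (size_scale_leq _ _) _.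
by rewrite size_polyX ltnS expn_gt0.
Qed.

(** For [|lambda| < 2 d] the orbit stays away from 0 after time [N], so [orbit_poly] has no root
    there and [mean_potential_poly] applies at each time [k + N]. *)
Lemma green_mean_potential c0 w N d : 0 < d -> 2 * d <= 1 ->
  (forall lambda, normc lambda < 2 * d ->
    normc c0 + 3 <= normc (random_orbit c0 lambda w N 0)) ->
  mean_potential d (fun lambda => green c0 lambda w 0).
Proof.
move=> d0 d1 hN.
apply: (mean_potential_lim _ (fun k lambda =>
  2 ^- (k + N) * ln (normc (random_orbit c0 lambda w (k + N) 0)))); last first.
  by move=> z zd; apply: green_cvg; [lra|apply: hN; lra].
move=> k.
have := @mean_potential_poly R d (orbit_poly c0 w (k + N)) (2 ^ (k + N)) d0.
rewrite expn_gt0 size_orbit_poly => /(_ isT isT).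
have -> : (fun z => (2 ^ (k + N))%:R^-1 *
      ln (normc (orbit_poly c0 w (k + N)).[z])) =
    (fun z => 2 ^- (k + N) * ln (normc (random_orbit c0 z w (k + N) 0))).
  by apply/funext => z; rewrite horner_orbit_poly natrX.
apply=> z zd; rewrite horner_orbit_poly -normc_gt0.
apply: lt_le_trans (orbit_escapes c0 z w N _ _ k).
- by have := normc_ge0 c0; lra.
- lra.
- exact: hN.
Qed.

End RandomOrbits.

(** * Measurability in the noise and integrability of the Green function *)

Section Measurability.
Context {R : realType}.
Local Open Scope complex_scope.
Implicit Types (z c lambda : R[i]) (d : R).

Lemma open_complex_lipschitz (f : R[i] -> R) (a : R) :
  (forall z z', `|f z - f z'| <= normc (z - z')) ->
  open ([set z | a < f z] : set R[i]^o).
Proof.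
move=> hf; rewrite openE => z az.
(* Balls of [R[i]^o] have radii in [R[i]], so the real radius [f z - a] is embedded. *)
rewrite /interior; apply/nbhs_ballP; exists (f z - a)%:C.
  by rewrite /= ltcR subr_gt0.
move=> z'; rewrite /ball /= => zz'.
have {zz'} : normc (z - z') < f z - a by rewrite -ltcR.
by have := hf z z'; rewrite ler_norml => /andP[_]; lra.
Qed.

Lemma measurable_udisk_lipschitz (f : R[i] -> R) :
  (forall z z', `|f z - f z'| <= normc (z - z')) ->
  measurable_fun setT (fun v : udisk_borel R => f (udisk_val v)).
Proof.
move=> hf; apply: (measurability _ (RGenOInfty.measurableE R)).
move=> /= _ [_ [a ->] <-]; rewrite setTI; apply: sub_sigma_algebra.
exists [set z | a < f z]; first exact: open_complex_lipschitz.
by apply/seteqP; split => v /=; rewrite in_itv/= andbT.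
Qed.

Lemma measurable_coordinate n :
  measurable_fun setT (fun w : Omega R => (w n : udisk_borel R)).
Proof.
move=> _ A mA; apply: sub_sigma_algebra; exists n => //.
by exists A.
Qed.

Lemma measurable_Re_coordinate n :
  measurable_fun setT (fun w : Omega R => complex.Re (udisk_val (w n))).
Proof.
have mRe : measurable_fun setT
  (fun v : udisk_borel R => complex.Re (udisk_val v)).
  apply: measurable_udisk_lipschitz => z z'.
  by rewrite -ReB; exact: normr_Re_le.
exact: (measurableT_comp mRe (measurable_coordinate n)).
Qed.

Lemma measurable_Im_coordinate n :
  measurable_fun setT (fun w : Omega R => complex.Im (udisk_val (w n))).
Proof.
have mIm : measurable_fun setT
  (fun v : udisk_borel R => complex.Im (udisk_val v)).
  apply: measurable_udisk_lipschitz => z z'.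
  (* Multiplication by [- 'i] turns imaginary parts into real parts and preserves the modulus. *)
  have -> : complex.Im z - complex.Im z' = complex.Re ((z - z') * - 'i).
    by case: z z' => x y [x' y'] /=; ring.
  apply: le_trans (normr_Re_le _) _.
  by rewrite normcM normcN_eq normc_i mulr1.
exact: (measurableT_comp mIm (measurable_coordinate n)).
Qed.

(** In real and imaginary parts the recursion is a real polynomial in measurable functions, so both
    parts are carried through the induction together. *)
Lemma measurable_random_orbit c0 lambda n :
  measurable_fun setT
    (fun w : Omega R => complex.Re (random_orbit c0 lambda w n 0)) /\
  measurable_fun setT
    (fun w : Omega R => complex.Im (random_orbit c0 lambda w n 0)).
Proof.
elim: n => [|n [mRe mIm]]; first by split; exact: measurable_cst.
have mvRe := measurable_Re_coordinate n.
have mvIm := measurable_Im_coordinate n.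
set x := fun w : Omega R => complex.Re _ in mRe.
set y := fun w : Omega R => complex.Im _ in mIm.
set vx := fun w : Omega R => complex.Re _ in mvRe.
set vy := fun w : Omega R => complex.Im _ in mvIm.
have mM (f g : Omega R -> R) : measurable_fun setT f ->
  measurable_fun setT g -> measurable_fun setT (fun w => f w * g w).
  exact: measurable_funM.
have mD (f g : Omega R -> R) : measurable_fun setT f ->
  measurable_fun setT g -> measurable_fun setT (fun w => f w + g w).
  exact: measurable_funD.
have mC (r : R) : measurable_fun setT (fun _ : Omega R => r).
  exact: measurable_cst.
split.
- rewrite (_ : (fun w => _) = (fun w => x w * x w + (-1) * (y w * y w) +
    (complex.Re c0 + (complex.Re lambda * vx w +
     (- complex.Im lambda) * vy w)))).
    exact: (mD _ _ (mD _ _ (mM _ _ mRe mRe) (mM _ _ (mC _) (mM _ _ mIm mIm)))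
      (mD _ _ (mC _) (mD _ _ (mM _ _ (mC _) mvRe) (mM _ _ (mC _) mvIm)))).
  apply/funext => w; rewrite /x /y /vx /vy /= /quad.
  case: (random_orbit _ _ _ _ _) => a b; case: (udisk_val _) => e f.
  by rewrite expr2; move: (c0) (lambda) => [p q] [r s] /=; ring.
- rewrite (_ : (fun w => _) = (fun w => 2 * (x w * y w) +
    (complex.Im c0 + (complex.Re lambda * vy w + complex.Im lambda * vx w)))).
    exact: (mD _ _ (mM _ _ (mC _) (mM _ _ mRe mIm))
      (mD _ _ (mC _) (mD _ _ (mM _ _ (mC _) mvIm) (mM _ _ (mC _) mvRe)))).
  apply/funext => w; rewrite /x /y /vx /vy /= /quad.
  case: (random_orbit _ _ _ _ _) => a b; case: (udisk_val _) => e f.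
  by rewrite expr2; move: (c0) (lambda) => [p q] [r s] /=; ring.
Qed.

Lemma measurable_ln_random_orbit c0 lambda n :
  measurable_fun setT
    (fun w : Omega R => ln (normc (random_orbit c0 lambda w n 0))).
Proof.
have [mRe mIm] := measurable_random_orbit c0 lambda n.
have msqrt : measurable_fun setT (@Num.sqrt R).
  by apply: continuous_measurable_fun; exact: sqrt_continuous.
have := measurableT_comp (@measurable_ln R) (measurableT_comp msqrt
  (measurable_funD (measurable_funX 2 mRe) (measurable_funX 2 mIm))).
congr (measurable_fun _ _); apply/funext => w /=.
by case: (random_orbit _ _ _ _ _).
Qed.

(** The Green function is measurable as a pointwise limit and, by [green_bounds], bounded uniformly
    in [w]. *)
Lemma green_integrable c0 lambda N M (P : probability (Omega R) R) :
  normc lambda <= 1 ->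
  (forall w : Omega R,
    normc c0 + 3 <= normc (random_orbit c0 lambda w N 0) <= M) ->
  P.-integrable setT (fun w => (green c0 lambda w 0)%:E).
Proof.
move=> l1 hN.
have lo w : normc c0 + 3 <= normc (random_orbit c0 lambda w N 0).
  by have /andP[] := hN w.
have up w : normc (random_orbit c0 lambda w N 0) <= M.
  by have /andP[] := hN w.
have mg : measurable_fun setT (fun w : Omega R => green c0 lambda w 0).
  pose f k (w : Omega R) : R :=
    2 ^- (k + N) * ln (normc (random_orbit c0 lambda w (k + N) 0)).
  have mf k : measurable_fun setT (f k).
    exact: measurable_funM (measurable_cst _)
      (measurable_ln_random_orbit c0 lambda (k + N)).
  by apply: (measurable_fun_cvg mf) => w _; exact: green_cvg.
have i0 : 0 <= (2 ^- N : R) by rewrite invr_ge0 exprn_ge0.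
apply: (@le_integrable _ _ _ _ _ _ _
  (EFin \o cst (2 ^- N * ln M + 2 ^- N))) => //.
- exact/measurable_EFinP.
- move=> w _ /=; rewrite lee_fin.
  have /andP[g0 g1] := green_bounds c0 lambda w N l1 (lo w).
  rewrite (ger0_norm g0); apply: le_trans (ler_norm _).
  apply: le_trans g1 _; rewrite lerD2r ler_wpM2l//.
  have z0 : 0 < normc (random_orbit c0 lambda w N 0).
    by apply: lt_le_trans (lo w); have := normc_ge0 c0; lra.
  by rewrite ler_ln ?posrE ?up//; apply: lt_le_trans (up w).
- exact: finite_measure_integrable_cst.
Qed.

End Measurability.

(** * Choice of the radius and harmonicity of the mean Green function *)

Theorem proposition42 (R : realType) (c0 : R[i]%C) (hc0 : ~ mandelbrot c0) :
  exists delta0 : R, 0 < delta0 /\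
    forall (nu : probability (udisk_borel R) R) (P : probability (Omega R) R),
      is_product_distribution nu P ->
      (forall lambda : R[i]%C, cdisk delta0 lambda ->
         integrable P setT (fun w => (green c0 lambda w 0)%:E)) /\
      harmonic_on (cdisk delta0) (mean_green c0 P 0).
Proof.
(* The escape threshold [|c0| + 3] plus a margin of 1 for the perturbation by the noise. *)
have [N hN] := not_mandelbrot_escape c0 (normc c0 + 4) hc0.
have [K K0 near_orbit] := random_orbit_near c0 N.
set z0 := iter N (quad c0) 0 in hN near_orbit.
(* Then [2 d = (K + 1)^-1], so [|lambda| < 2 d] gives both [|lambda| <= 1] and [K |lambda| <= 1].
   Both [N] and [K] come from [c0], before [nu] and [P] are introduced. *)
pose d := (2 * (K + 1))^-1.
have d0 : 0 < d by rewrite invr_gt0; move: K0; lra.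
have dE : d * (2 * (K + 1)) = 1 by rewrite mulVf// gt_eqF//; move: K0; lra.
have d1 : 2 * d <= 1 by have := mulr_ge0 (ltW d0) K0; lra.
have escape lambda : normc lambda < 2 * d -> forall w : nat -> udisk R,
    normc c0 + 3 <= normc (random_orbit c0 lambda w N 0) <= normc z0 + 1.
  move=> ld w; have l1 : normc lambda <= 1 by lra.
  have := near_orbit lambda w l1; set z := random_orbit _ _ _ _ _ => zz0.
  have : K * normc lambda <= 1.
    by have := ler_wpM2l K0 (ltW ld); have := mulr_ge0 (ltW d0) K0; lra.
  have := normcD_le (z - z0) z0; have := normcD_le (z0 - z) z.
  rewrite !subrK (normc_distC z0) => h1 h2 h3.
  by apply/andP; split; lra.
have integrable_green (P : probability (Omega R) R) lambda :
    cdisk d lambda -> integrable P setT (fun w => (green c0 lambda w 0)%:E).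
  move=> ld; apply: (green_integrable c0 lambda N (normc z0 + 1)).
    by move: (ld : normc lambda < d); lra.
  by move=> w; apply: escape; move: (ld : normc lambda < d); lra.
exists d; split=> // nu P _; split; first exact: integrable_green.
apply: mean_potential_harmonic => //.
apply: (mean_potential_mean d _ _ P (fun w lambda => green c0 lambda w 0)).
  move=> w; apply: (green_mean_potential c0 w N) => // lambda ld.
  by have /andP[] := escape lambda ld w.
by move=> z; exact: integrable_green.
Qed.
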